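(* Let $k=k(n)$ be a positive integer function of $n$ with $k\le n$. With probability $1-O(1/n)$ as $n\to\infty$, a uniformly random $k\times n$ Latin rectangle has no proper subsquare of order $4$ or more.
   Context: A $k\times n$ Latin rectangle (with $k\le n$ positive integers) is a $k\times n$ matrix on $n$ symbols (the symbol set is $[n]=\{1,\dots,n\}$), each of which occurs at most once in each row and column. If $k=n$ it is a Latin square of order $n$. A subsquare of a Latin rectangle $L$ is a submatrix of $L$ (induced by a set of rows and a set of columns, not necessarily contiguous) which is itself a Latin square; its order is its number of rows. A subsquare of a $k\times n$ Latin rectangle is proper if its order lies in $\{2,3,\dots,n-1\}$. Asymptotics are as $n\to\infty$, with $k$ a function of $n$. *)

(* Defs.v *)
From mathcomp Require Import all_boot all_order all_algebra.

Set Implicit Arguments.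
Unset Strict Implicit.
Unset Printing Implicit Defensive.

Import Order.TTheory GRing.Theory Num.Theory.
Local Open Scope ring_scope.

(* The symbol set S is a parameter because a submatrix of a matrix on the
   symbols 'I_n can be Latin on any subset of 'I_n of the right size. *)
Definition latin_rectangle (T : finType) (k n : nat) (S : {set T})
    (A : 'M[T]_(k, n)) : bool :=
  [&& (0 < k <= n)%N,
      #|S| == n,
      [forall i, forall j, A i j \in S],
      [forall i, forall s in S, (#|[set j | A i j == s]| <= 1)%N] &
      [forall j, forall s in S, (#|[set i | A i j == s]| <= 1)%N]].

(* Stated on k x n matrices so that it applies to submatrices, whose
   dimensions #|I| and #|J| are not convertible. *)
Definition latin_square (T : finType) (k n : nat) (S : {set T})
    (A : 'M[T]_(k, n)) : bool :=
  (k == n) && latin_rectangle S A.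

Definition submatrix (T : Type) (k n : nat) (L : 'M[T]_(k, n))
    (I : {set 'I_k}) (J : {set 'I_n}) : 'M[T]_(#|I|, #|J|) :=
  mxsub (@enum_val _ (mem I)) (@enum_val _ (mem J)) L.

Definition subsquare (T : finType) (k n : nat) (L : 'M[T]_(k, n))
    (I : {set 'I_k}) (J : {set 'I_n}) : bool :=
  [exists S : {set T}, latin_square S (submatrix L I J)].

Definition proper_subsquare (T : finType) (k n : nat) (L : 'M[T]_(k, n))
    (I : {set 'I_k}) (J : {set 'I_n}) : bool :=
  subsquare L I J && (2 <= #|I| <= n - 1)%N.

Definition has_proper_subsquare_ge (T : finType) (m k n : nat)
    (L : 'M[T]_(k, n)) : bool :=
  [exists I : {set 'I_k}, exists J : {set 'I_n},
    proper_subsquare L I J && (m <= #|I|)%N].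

Definition latin_rectangles (k n : nat) : {set 'M['I_n]_(k, n)} :=
  [set L | latin_rectangle [set: 'I_n] L].

Definition finite_uniform_prob (R : numFieldType) (T : finType) (A : {set T})
    (E : pred T) : R :=
  #|[set x in A | E x]|%:R / #|A|%:R.

(* Main.v *)
(* Fix the row set I, column set J and symbol set S of a would-be subsquare of
   order s. Pick a column c of J and, for the rows of I one after the other,
   exchange columns c and c', for an arbitrary c' outside J, along the connected
   component (cycle or path) of that row in the graph of these two columns.
   Permuting the symbols inside the subsquare beforehand ensures that the
   component meets no other row of I that is still intact, and since row i of
   the rest of the subsquare lacks exactly one symbol of S, that symbol reveals
   c' afterwards. Hence #(rectangles with the subsquare) * (n - s)^s is at most
   s! times the number of rectangles in which only the columns J \ c are intact.
   Exchanging the roles of columns and symbols, one symbol x of S can be removed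
   in the same way, which gains another factor (n - s)^(s-1) / s!.

   What is left determines I, J and S from c, x, one row and the set S \ x, so
   the expected number of subsquares of order s is at most
   s!^2 n^2 k C(n, s-1) / (n - s)^(2s-1). A subsquare has order at most n / 2, and
   by AM-GM this is at most n^3 s rho^s with rho <= min (7/8, 4 s / n), which is
   O(s^5 (7/8)^s / n); summing over s >= 4 gives O(1/n). *)

Require Import Defs.
From mathcomp Require Import all_boot all_fingroup all_order all_algebra.
From mathcomp Require Import zify ring lra.

Set Implicit Arguments.
Unset Strict Implicit.
Unset Printing Implicit Defensive.

Import Order.TTheory GRing.Theory Num.Theory.
Local Open Scope nat_scope.

(** * Finite permutations: extension and first returns *)

(** A permutation agreeing with [f] on as much of [D] as possible agrees on all of it: composing
    with [tperm (s x) (f x)] would gain [x] and lose nothing. *)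
Lemma perm_extension (T : finType) (D : {set T}) (f : T -> T) :
  {in D &, injective f} -> exists s : {perm T}, {in D, s =1 f}.
Proof.
move=> f_inj; pose good (s : {perm T}) := [set x in D | s x == f x].
case: (@arg_maxnP _ 1%g predT (fun s => #|good s|) isT) => s _ s_max.
exists s => x xD; apply/eqP; apply: contraT => sx.
have /= := s_max (s * tperm (s x) (f x))%g isT; rewrite leqNgt => /negP[].
apply/proper_card/properP; split.
  apply/subsetP => y; rewrite !inE permM => /andP[yD /eqP sy]; rewrite yD /=.
  rewrite tpermD ?sy //; last first.
    by apply: contra sx => /eqP/f_inj-> //; rewrite sy.
  by rewrite -sy (inj_eq perm_inj); apply: contra sx => /eqP->; rewrite sy.
exists x; first by rewrite inE xD permM tpermL eqxx.
by rewrite inE xD (negbTE sx).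
Qed.

(* [u] is the point of [X] to which the orbit of [i] under [phi] first returns,
   and [Z] is the part of the orbit before that. *)
Lemma first_return (T : finType) (phi : {perm T}) (X : {set T}) (i : T) :
  i \in X -> exists u (Z : {set T}), [/\ u \in X, i \in Z, Z :&: X = [set i] &
    forall r, (tperm i u (phi r) \in Z) = (r \in Z)].
Proof.
move=> iX.
have exp : exists p, (0 < p) && ((phi ^+ p)%g i \in X).
  by exists #[phi]%g; rewrite order_gt0 expg_order perm1.
case: (ex_minnP exp) => p /andP[p_gt0 pX] p_min.
have notX j : 0 < j < p -> (phi ^+ j)%g i \notin X.
  move=> /andP[j0 jp]; apply/negP => jX.
  by have := p_min j; rewrite j0 jX => /(_ isT); rewrite leqNgt jp.
pose u := (phi ^+ p)%g i; pose Z := [set (phi ^+ nat_of_ord j)%g i | j : 'I_p].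
have iZ : i \in Z by apply/imsetP; exists (Ordinal p_gt0); rewrite //= expg0 perm1.
exists u, Z; split=> //.
  apply/setP => x; rewrite !inE; apply/andP/eqP => [[/imsetP[j _ ->] +]|->//].
  case: (posnP j) => [->|j0]; first by rewrite expg0 perm1.
  by move=> jX; have := notX j; rewrite j0 ltn_ord jX => /(_ isT).
have psiZ : [set (phi * tperm i u)%g r | r in Z] \subset Z.
  apply/subsetP => _ /imsetP[_ /imsetP[j _ ->] ->]; rewrite permM -[phi _]permM -expgSr.
  case: (ltnP j.+1 p) => jp; last first.
    have -> : j.+1 = p by apply/eqP; rewrite eqn_leq jp ltn_ord.
    by rewrite -/u tpermR.
  have /= jX := notX j.+1 jp.
  rewrite tpermD; last 2 first.
  - by apply: contraNneq jX => <-.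
  - by apply: contraNneq jX => <-.
  by apply/imsetP; exists (Ordinal jp).
move=> r; rewrite -permM.
have /eqP ZE : [set (phi * tperm i u)%g r | r in Z] == Z.
  by rewrite eqEcard psiZ (card_imset _ perm_inj) leqnn.
by rewrite -[in LHS]ZE (mem_imset _ _ perm_inj).
Qed.

Lemma card_bigcup_leq (I : Type) (r : seq I) (P : pred I) (T : finType)
    (F : I -> {set T}) :
  #|\bigcup_(i <- r | P i) F i| <= \sum_(i <- r | P i) #|F i|.
Proof.
elim/big_rec2: _ => [|i m A _ le]; first by rewrite cards0.
by rewrite (leq_trans (leq_card_setU _ _)) // leq_add2l.
Qed.

(** * Latin rectangles and switching two columns along a component *)

Section Rectangles.
Variables k n : nat.
Implicit Types (L : 'M['I_n]_(k, n)) (I X Z : {set 'I_k}).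
Implicit Types (J S : {set 'I_n}) (i r u : 'I_k) (c d x y : 'I_n).

Definition latin L :=
  [forall i, injectiveb (L i)] && [forall d, injectiveb (L^~ d)].

Lemma latinP L :
  reflect ((forall i, injective (L i)) /\ (forall d, injective (L^~ d))) (latin L).
Proof.
apply: (iffP andP) => [[/forallP r /forallP c]|[r c]].
  by split=> [i|d]; apply/injectiveP.
by split; apply/forallP => ?; apply/injectiveP.
Qed.

Lemma latin_row L i c d : latin L -> L i c = L i d -> c = d.
Proof. by case/latinP=> + _; apply. Qed.

Lemma latin_col L i r d : latin L -> L i d = L r d -> i = r.
Proof. by case/latinP=> _ +; apply. Qed.

(** Rows of a Latin rectangle are permutations of ['I_n], so the default is never taken there. *)
Definition position L i x := odflt x [pick d | L i d == x].

Lemma positionK L i x : latin L -> L i (position L i x) = x.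
Proof.
move=> /latinP[+ _] => /(_ i)/injF_bij[g gK Kg].
rewrite /position; case: pickP => [d /eqP //|/(_ (g x))].
by rewrite Kg eqxx.
Qed.

Lemma positionE L i d : latin L -> position L i (L i d) = d.
Proof. by move=> Ll; apply: (latin_row (i := i) Ll); rewrite positionK. Qed.

Definition swap L c d Z :=
  (\matrix_(r, y) (if r \in Z then L r (tperm c d y) else L r y))%R.

Lemma swapK L c d Z : swap (swap L c d Z) c d Z = L.
Proof. by apply/matrixP => r y; rewrite !mxE tpermK; case: (r \in Z). Qed.

Definition adjacent L c d : rel 'I_k :=
  fun r r' => (L r c == L r' d) || (L r' c == L r d).

(** [Z] is a union of components, so a switched and an unswitched row never get the same symbol in
    column [c] or [d]. *)
Lemma latin_swap L c d Z : latin L -> c != d ->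
  (forall r r', L r c = L r' d -> (r \in Z) = (r' \in Z)) -> latin (swap L c d Z).
Proof.
move=> Ll cd ZE; apply/latinP; split.
  move=> r y y'; rewrite !mxE; case: ifP => _ /(latin_row Ll) //; exact: perm_inj.
move=> y r r' /=; rewrite !mxE.
case: tpermP => [->|->|_ _]; last by case: ifP; case: ifP => ? ?; apply: latin_col.
- case: ifP; case: ifP => r'Z rZ; try exact: (latin_col Ll).
  + by move/esym/ZE; rewrite rZ r'Z.
  + by move/ZE; rewrite rZ r'Z.
- case: ifP; case: ifP => r'Z rZ; try exact: (latin_col Ll).
  + by move/ZE; rewrite rZ r'Z.
  + by move/esym/ZE; rewrite rZ r'Z.
Qed.

Definition component L c d i := [set r | connect (adjacent L c d) i r].

Lemma adjacent_sym L c d : symmetric (adjacent L c d).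
Proof. by move=> r r'; rewrite /adjacent orbC. Qed.

Lemma component_closed L c d i r r' :
  L r c = L r' d -> (r \in component L c d i) = (r' \in component L c d i).
Proof.
move=> e; rewrite !inE; apply: same_connect1r.
  exact: sym_connect_sym (@adjacent_sym L c d).
by rewrite /adjacent e eqxx.
Qed.

Lemma component_min L c d i Z : i \in Z ->
  (forall r r', L r c = L r' d -> (r \in Z) = (r' \in Z)) ->
  component L c d i \subset Z.
Proof.
move=> iZ ZE; apply/subsetP => r; rewrite inE => ir.
suff cl : fingraph.closed (adjacent L c d) (mem Z) by rewrite -(closed_connect cl ir).
by move=> r1 r2 /orP[] /eqP/ZE ->.
Qed.

(** Adjacency is symmetric in [c] and [d], which settles pairs on one side of [Z]; a new edge across
    its boundary would repeat a symbol in a column. So, given [c] and [d], the switch can be undone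
    from the switched rectangle alone. *)
Lemma component_swap L c d i :
  latin L -> component (swap L c d (component L c d i)) c d i = component L c d i.
Proof.
move=> Ll; set Z := component L c d i.
have adjE : adjacent (swap L c d Z) c d =2 adjacent L c d.
  move=> r r'; rewrite /adjacent !mxE tpermL tpermR.
  case rZ: (r \in Z); case r'Z: (r' \in Z).
  - by rewrite orbC ![L _ d == _]eq_sym.
  - have /negbTE rr' : r != r' by apply: contraFneq r'Z => <-.
    have /negbTE-> : L r c != L r' d.
      by apply: contraTneq rZ => /component_closed->; rewrite -/Z r'Z.
    have /negbTE-> : L r' c != L r d.
      by apply: contraTneq rZ => /component_closed<-; rewrite -/Z r'Z.
    apply/negbTE/norP; split; apply: contraFneq rr' => e; apply/eqP.
      exact: latin_col e.
    by apply/esym; apply: latin_col e.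
  - have /negbTE rr' : r != r' by apply: contraTneq r'Z => <-; rewrite rZ.
    have /negbTE-> : L r c != L r' d.
      by apply: contraTneq r'Z => /component_closed<-; rewrite -/Z rZ.
    have /negbTE-> : L r' c != L r d.
      by apply: contraTneq r'Z => /component_closed->; rewrite -/Z rZ.
    apply/negbTE/norP; split; apply: contraFneq rr' => e; apply/eqP.
      exact: latin_col e.
    by apply/esym; apply: latin_col e.
  - by [].
by apply/setP => r; rewrite !inE (eq_connect adjE).
Qed.

(** * Partially intact subsquares and the switching step *)

Definition relabel L I x y :=
  (\matrix_(r, d) (if r \in I then tperm x y (L r d) else L r d))%R.

Definition missing L J S i := [set y in S | [forall d in J, L i d != y]].

(* What remains of a subsquare with row set [I], column set [c |: J] and symbol
   set [S] when column [c] is only required to be intact in the rows of [X]. It is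
   also used for conjugate rectangles: then [c |: J] is the symbol set, and [S] is
   the column set without the column removed before. *)
Definition block I J S c X : {set 'M['I_n]_(k, n)} :=
  [set L | [&& latin L, [forall d in J, S \subset [set L i d | i in I]],
    [forall i in I, #|missing L J S i| <= 1] & [forall i in X, L i c \in S]]].

Lemma blockP I J S c X L :
  reflect [/\ latin L, forall d y, d \in J -> y \in S -> exists2 i, i \in I & L i d = y,
    forall i, i \in I -> #|missing L J S i| <= 1 & forall i, i \in X -> L i c \in S]
  (L \in block I J S c X).
Proof.
rewrite inE; apply: (iffP and4P) => -[Ll cov mis XS]; split=> //.
- move=> d y dJ yS; move/forall_inP/(_ d dJ)/subsetP/(_ y yS): cov.
  by case/imsetP => i iI ->; exists i.
- by move=> i iI; move/forall_inP/(_ i iI): mis.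
- by move=> i iX; move/forall_inP/(_ i iX): XS.
- apply/forall_inP => d dJ; apply/subsetP => y yS.
  by have [i iI <-] := cov d y dJ yS; apply: imset_f.
- exact/forall_inP.
- exact/forall_inP.
Qed.

(** A row contains [y] only once, so the columns of [J] find [y] in distinct rows of [I]. *)
Lemma block_rows I J S c X L y : L \in block I J S c X -> y \in S ->
  #|J| <= #|[set i in I | [exists d in J, L i d == y]]|.
Proof.
move=> /blockP[Ll cov _ _] yS.
rewrite (leq_trans _ (leq_imset_card (fun i => position L i y) _)) //.
apply/subset_leq_card/subsetP => d dJ; have [i iI e] := cov d y dJ yS.
apply/imsetP; exists i; last by rewrite -e positionE.
by rewrite inE iI; apply/exists_inP; exists d; rewrite // e.
Qed.

(** By [block_rows] at most one row of [I] lacks the symbol in [J], and row [i], which has it in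
    column [c], is that row. *)
Lemma block_occurs I J S c X L i r :
    #|J|.+1 = #|I| -> c \notin J -> L \in block I J S c X ->
    i \in I -> L i c \in S -> r \in I -> r != i ->
  exists2 d, d \in J & L r d = L i c.
Proof.
move=> cardJ cJ LB iI iS rI ri; have Ll : latin L by case/blockP: LB.
pose R := [set r in I | [exists d in J, L r d == L i c]].
suff : r \in R by rewrite inE => /andP[_ /exists_inP[d dJ /eqP]]; exists d.
have RI : R \subset I :\ i.
  apply/subsetP => r'; rewrite !inE => /andP[-> /exists_inP[d dJ /eqP e]].
  rewrite andbT; apply: contraNneq cJ => ri'; rewrite ri' in e.
  by rewrite -(latin_row Ll e).
suff /eqP-> : R == I :\ i by rewrite !inE ri.
rewrite eqEcard RI /=; have := cardsD1 i I; rewrite iI -cardJ add1n => /succn_inj<-.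
exact: block_rows LB iS.
Qed.

Lemma block_unique I J S c X L i r d :
    #|J|.+1 = #|I| -> c \notin J -> L \in block I J S c X ->
    i \in I -> L i c \in S -> r \in I -> L r d = L i c ->
  d \in J \/ r = i /\ d = c.
Proof.
move=> cardJ cJ LB iI iS rI e; have Ll : latin L by case/blockP: LB.
have [ri|ri] := eqVneq r i.
  by right; split=> //; apply: (latin_row Ll (i := i)); rewrite -e ri.
left; have [d' d'J e'] := block_occurs cardJ cJ LB iI iS rI ri.
by rewrite (latin_row Ll (etrans e (esym e'))).
Qed.

(** In column [c] this just exchanges the entries of rows [i] and [u]: it redirects the component of
    row [i] without damaging the block. *)
Lemma block_relabel I J S c X L i u :
    #|J|.+1 = #|I| -> c \notin J -> X \subset I -> L \in block I J S c X ->
    i \in X -> u \in X ->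
  relabel L I (L i c) (L u c) \in block I J S c X.
Proof.
move=> cardJ cJ /subsetP XI LB iX uX.
have [Ll cov mis XS] := blockP _ _ _ _ _ _ LB.
set v := L i c; set w := L u c.
have vS : v \in S by apply: XS.
have wS : w \in S by apply: XS.
have tS y : (tperm v w y \in S) = (y \in S) by case: tpermP => [->|->|//]; rewrite vS wS.
have uniq := block_unique cardJ cJ LB.
(* In every column where the entries of rows in [I] change, the two exchanged
   symbols both lie in rows of [I]. *)
have inI r r' d : r \in I -> L r' d = tperm v w (L r d) -> r' \in I.
  move=> rI; case: tpermP => [e|e|_ _ /(latin_col Ll)->//] e'.
  - have [dJ|[_ dc]] := uniq _ _ _ (XI _ iX) vS rI e.
      by have [r'' r''I] := cov d w dJ wS; rewrite -e' => /(latin_col Ll)<-.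
    by move: e'; rewrite dc => /(latin_col Ll)->; apply: XI.
  - have [dJ|[_ dc]] := uniq _ _ _ (XI _ uX) wS rI e.
      by have [r'' r''I] := cov d v dJ vS; rewrite -e' => /(latin_col Ll)<-.
    by move: e'; rewrite dc => /(latin_col Ll)->; apply: XI.
apply/blockP; split.
- apply/latinP; split=> [r d d'|d r r'] /=; rewrite !mxE.
    by case: ifP => _; [move/perm_inj|]; apply: latin_row.
  case: ifP => rI; case: ifP => r'I.
  + by move/perm_inj; apply: latin_col.
  + by move/esym/(inI _ _ _ rI); rewrite r'I.
  + by move/(inI _ _ _ r'I); rewrite rI.
  + exact: latin_col.
- move=> d y dJ yS; have := yS; rewrite -tS => /(cov d _ dJ)[r rI e].
  by exists r; rewrite // mxE rI e tpermK.
- move=> r rI; rewrite (leq_trans _ (mis r rI)) //.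
  rewrite -(card_imset _ (@perm_inj _ (tperm v w))).
  apply/subset_leq_card/subsetP => _ /imsetP[y + ->].
  rewrite !inE tS => /andP[-> /forall_inP yP] /=; apply/forall_inP => d dJ.
  by have := yP d dJ; rewrite mxE rI; apply: contraNneq => ->; rewrite tpermK.
- by move=> r rX; rewrite mxE XI // tS XS.
Qed.

(* The pair (L, c') is recovered from the switched rectangle and the row [u] used
   for relabelling: row [i] of the block lacks a single symbol, which sits in
   column [c']. *)
Lemma block_step I J S c X i :
    #|J|.+1 = #|I| -> c \notin J -> X \subset I -> i \in X ->
  #|block I J S c X| * (n - #|I|) <= #|block I J S c (X :\ i)| * #|X|.
Proof.
move=> cardJ cJ XI iX.
have iI : i \in I by apply: (subsetP XI).
pose lost L := odflt c [pick y in missing L J S i].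
pose undo (p : 'M['I_n]_(k, n) * 'I_k) :=
  let c' := position p.1 i (lost p.1) in
  let L := swap p.1 c c' (component p.1 c c' i) in
  (relabel L I (L i c) (L p.2 c), c').
have -> : n - #|I| = #|~: (c |: J)|.
  by rewrite [RHS]cardsCs setCK cardsU1 cJ add1n cardJ card_ord.
rewrite -!cardsX (leq_trans _ (leq_imset_card undo _)) //.
apply/subset_leq_card/subsetP => -[L c']; rewrite inE /= => /andP[LB].
rewrite !inE negb_or => /andP[c'c c'J].
have [Ll cov mis XS] := blockP _ _ _ _ _ _ LB.
pose D := [set r | [exists r', L r' c == L r c']].
pose f r := odflt r [pick r' | L r' c == L r c'].
have fP r r' : L r' c = L r c' -> f r = r'.
  move=> e; rewrite /f; case: pickP => [r'' /eqP e'|/(_ r')]; last by rewrite e eqxx.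
  by apply: (latin_col Ll (d := c)); rewrite e e'.
(* [phi] sends a row to the one whose entry in column [c] is its own entry in column [c']; it is
   extended to a permutation so that every path lies on a cycle. *)
have [phi phiE] : exists phi : {perm 'I_k}, {in D, phi =1 f}.
  apply: perm_extension => r1 r2.
  rewrite !inE => /existsP[s1 /eqP e1] /existsP[s2 /eqP e2].
  rewrite (fP _ _ e1) (fP _ _ e2) => s12; apply: (latin_col Ll (d := c')).
  by rewrite -e1 -e2 s12.
have {phiE} phiP r r' : L r' c = L r c' -> phi r = r'.
  by move=> e; rewrite phiE ?(fP r r') // inE; apply/existsP; exists r'; rewrite e.
(* Relabelling redirects the step into [u], the first row of [X] met after [i], back to [i]; the
   component of [i] then stays in [Z] and meets [X] only in [i]. *)
have [u [Z [uX iZ ZX phiZ]]] := first_return phi iX.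
pose Lu := relabel L I (L i c) (L u c).
have LuB : Lu \in block I J S c X by apply: block_relabel.
have [Lul covu misu XSu] := blockP _ _ _ _ _ _ LuB.
have uI : u \in I by apply: (subsetP XI).
have Luc r : Lu r c = L (tperm i u r) c.
  rewrite mxE; case: ifP => rI; last by rewrite tpermD //; apply: contraFneq rI => <-.
  exact/esym/(inj_tperm i u r (proj2 (latinP _ Ll) c)).
(* Outside [J] and column [c], the rows of [I] do not contain the exchanged symbols. *)
have Luc' r : Lu r c' = L r c'.
  rewrite mxE; case: ifP => rI //; rewrite tpermD //.
    apply/eqP => /esym e.
    have [/idPn//|[_ c'E]] := block_unique cardJ cJ LB iI (XS i iX) rI e.
    by rewrite c'E eqxx in c'c.
  apply/eqP => /esym e.
  have [/idPn//|[_ c'E]] := block_unique cardJ cJ LB uI (XS u uX) rI e.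
  by rewrite c'E eqxx in c'c.
pose C := component Lu c c' i.
have iC : i \in C by rewrite inE connect0.
have CZ : C \subset Z.
  apply: component_min => // r r'; rewrite Luc Luc' => /phiP e.
  by rewrite -(phiZ r') e tpermK.
pose L' := swap Lu c c' C.
have L'l : latin L'.
  by apply: latin_swap => [//||r r']; [rewrite eq_sym|apply: component_closed].
have L'J r d : d \in J -> L' r d = Lu r d.
  move=> dJ; rewrite mxE tpermD ?if_same //; first by apply: contraNneq cJ => ->.
  by apply: contraNneq c'J => ->.
have missE r : missing L' J S r = missing Lu J S r.
  apply/setP => y; rewrite !inE; congr (_ && _).
  by apply: eq_forallb_in => d dJ; rewrite L'J.
apply/imsetP; exists (L', u).
  rewrite in_setX uX andbT; apply/blockP; split=> //.
  - by move=> d y dJ /(covu d y dJ)[r rI <-]; exists r; rewrite ?L'J.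
  - by move=> r rI; rewrite missE misu.
  - move=> r; rewrite !inE => /andP[ri rX]; rewrite mxE.
    case: ifP => [/(subsetP CZ) rZ|_]; last exact: XSu.
    by have := in_set1 r i; rewrite -ZX inE rZ rX (negbTE ri).
(* The symbol that row [i] lacks in [J] is its entry of column [c] before the switch, which has
   moved to column [c']. *)
have lostE : lost L' = Lu i c.
  have m : Lu i c \in missing Lu J S i.
    rewrite inE XSu //=; apply/forall_inP => d dJ; apply: contraNneq cJ.
    by move/(latin_row Lul) <-.
  rewrite /lost missE; case: pickP => [y ym /=|/(_ (Lu i c))]; last by rewrite m.
  have /card_le1P/(_ _ m y) := misu i iI.
  by rewrite ym inE => /esym/eqP.
have c'E : position L' i (lost L') = c'.
  have -> : lost L' = L' i c' by rewrite lostE [RHS]mxE iC tpermR.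
  exact: positionE.
rewrite /undo /= c'E /L' component_swap // swapK; congr pair.
apply/matrixP => r d; rewrite !Luc tpermL tpermR !mxE tpermC.
by case: (r \in I); rewrite ?tpermK.
Qed.

Lemma block_card I J S c X :
    #|J|.+1 = #|I| -> c \notin J -> X \subset I ->
  #|block I J S c X| * (n - #|I|) ^ #|X| <= #|X|`! * #|block I J S c set0|.
Proof.
move=> cardJ cJ; move: {2}#|X| (erefl #|X|) => m; elim: m X => [|m IH] X Xm XI.
  by move/eqP: Xm; rewrite cards_eq0 => /eqP->; rewrite cards0 expn0 muln1 mul1n.
have /card_gt0P[i iX] : 0 < #|X| by rewrite Xm.
have Xim : #|X :\ i| = m by move: Xm; rewrite (cardsD1 i X) iX add1n => /succn_inj.
have := IH (X :\ i) Xim (subset_trans (subD1set X i) XI).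
rewrite Xim Xm expnS mulnA => IHi.
rewrite (leq_trans (leq_mul (block_step S cardJ cJ XI iX) (leqnn _))) //.
by rewrite Xm mulnAC mulnC factS -mulnA leq_mul2l IHi orbT.
Qed.

(** * Exchanging columns and symbols *)

Definition conjugate L := (\matrix_(i, x) position L i x)%R.

Lemma latin_conjugate L : latin L -> latin (conjugate L).
Proof.
move=> Ll; apply/latinP; split=> [i x y|x i r] /=; rewrite !mxE => e.
  by rewrite -(positionK i x Ll) e positionK.
by apply: (latin_col Ll (d := position L i x)); rewrite positionK // e positionK.
Qed.

Lemma conjugate_inj : {in latin &, injective conjugate}.
Proof.
move=> L L' Ll L'l /matrixP e; apply/matrixP => i d.
have := e i (L i d); rewrite !mxE positionE // => dE.
by rewrite [in RHS]dE positionK.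
Qed.

Definition with_subsquare I J S : {set 'M['I_n]_(k, n)} :=
  [set L | latin L && [forall i in I, forall d in J, L i d \in S]].

Lemma with_subsquare_block I J S c : #|J| = #|I| -> #|S| = #|I| -> c \in J ->
  with_subsquare I J S \subset block I (J :\ c) S c I.
Proof.
move=> cardJ cardS cJ; apply/subsetP => L; rewrite inE => /andP[Ll LS].
have {}LS i d : i \in I -> d \in J -> L i d \in S.
  by move=> iI dJ; move/forall_inP/(_ i iI)/forall_inP: LS; apply.
apply/blockP; split=> // [d y|i iI|i iI]; last exact: LS.
  rewrite in_setD1 => /andP[_ dJ] yS.
  suff /eqP E : [set L i d | i in I] == S.
    by move: yS; rewrite -E => /imsetP[i iI ->]; exists i.
  rewrite eqEcard cardS card_imset ?leqnn ?andbT; last by move=> i r; apply: latin_col.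
  by apply/subsetP => _ /imsetP[i iI ->]; apply: LS.
pose T := [set L i d | d in J :\ c].
have TS : T \subset S.
  by apply/subsetP => _ /imsetP[d /setD1P[_ dJ] ->]; apply: LS.
have cardT : #|T|.+1 = #|S|.
  rewrite card_imset; last by move=> d d'; apply: latin_row.
  by rewrite cardS -cardJ (cardsD1 c J) cJ.
have -> : missing L (J :\ c) S i = S :\: T.
  apply/setP => y; rewrite !inE [RHS]andbC; congr (_ && _).
  apply/forall_inP/negP => [yJ /imsetP[d dJ e]|yT d dJ].
    by have := yJ d dJ; rewrite e eqxx.
  by apply/eqP => e; apply: yT; apply/imsetP; exists d.
by rewrite cardsD (setIidPr TS) -cardT subSnn.
Qed.

(** [rho] is the row of [I] without [x] in the columns of [J]; [block_rows] leaves at most one, and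
    if there is none any row serves. A column of [J] missing from a conjugate row holds [x] there,
    hence is unique. *)
Lemma block_conjugate I J S c x L :
    #|J|.+1 = #|I| -> #|S| = #|I| -> x \in S -> L \in block I J S c set0 ->
  exists2 rho, rho \in I & conjugate L \in block I (S :\ x) J x (I :\ rho).
Proof.
move=> cardJ cardS xS LB; have [Ll cov _ _] := blockP _ _ _ _ _ _ LB.
have LS i d : i \in I -> d \in J -> L i d \in S.
  move=> iI dJ; suff /eqP-> : S == [set L i d | i in I] by apply: imset_f.
  rewrite eqEcard cardS leq_imset_card andbT.
  by apply/subsetP => y /(cov d y dJ)[r rI <-]; apply: imset_f.
have [rho rhoI xJ] : exists2 rho, rho \in I & forall i, i \in I :\ rho -> position L i x \in J.
  pose H := [set i in I | [exists d in J, L i d == x]].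
  have HJ i : i \in H -> position L i x \in J.
    by rewrite inE => /andP[_ /exists_inP[d dJ /eqP<-]]; rewrite positionE.
  have HI : H \subset I by apply/subsetP => i; rewrite inE => /andP[].
  have cardH : #|J| <= #|H| by apply: block_rows LB xS.
  have [IH|] := boolP (I \subset H).
    have /card_gt0P[rho rhoI] : 0 < #|I| by rewrite -cardJ.
    by exists rho => // i /setD1P[_ iI]; apply/HJ/(subsetP IH).
  case/subsetPn => rho rhoI rhoH; exists rho => // i.
  suff /eqP<- : H == I :\ rho by apply: HJ.
  rewrite eqEcard subsetD1 HI rhoH /=.
  by have := cardsD1 rho I; rewrite rhoI -cardJ add1n => /succn_inj<-.
exists rho => //; apply/blockP; split.
- exact: latin_conjugate.
- move=> y d /setD1P[_ yS] dJ; have [i iI <-] := cov d y dJ yS.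
  by exists i; rewrite // mxE positionE.
- move=> i iI; have missE d : d \in missing (conjugate L) (S :\ x) J i -> L i d = x.
    rewrite inE => /andP[dJ /forall_inP dm]; apply/eqP; apply: contraT => dx.
    by have := dm (L i d); rewrite !inE dx LS // mxE positionE // eqxx => /(_ isT).
  apply/card_le1_eqP => d d' /missE e /missE e'.
  by apply: (latin_row Ll (i := i)); rewrite e e'.
- by move=> i /xJ; rewrite mxE.
Qed.

(** Two rounds of [block_card]: for column [c], then after conjugation for symbol [x]. The choice of
    [rho] supplies the factor [#|I|] that completes the second factorial. *)
Lemma with_subsquare_card I J S c x :
    #|J| = #|I| -> #|S| = #|I| -> c \in J -> x \in S ->
  #|with_subsquare I J S| * (n - #|I|) ^ (2 * #|I|).-1
    <= #|I|`! ^ 2 * #|block I (S :\ x) (J :\ c) x set0|.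
Proof.
move=> cardJ cardS cJ xS.
have cardJ1 : #|J :\ c|.+1 = #|I| by rewrite -cardJ (cardsD1 c J) cJ.
have cardS1 : #|S :\ x|.+1 = #|I| by rewrite -cardS (cardsD1 x S) xS.
set N := n - #|I|; set B := block I (S :\ x) (J :\ c) x set0.
have first : #|with_subsquare I J S| * N ^ #|I| <= #|I|`! * #|block I (J :\ c) S c set0|.
  rewrite (leq_trans _ (block_card S cardJ1 (negbT (setD11 c J)) (subxx I))) //.
  by rewrite leq_mul2r subset_leq_card ?orbT // with_subsquare_block.
have second : #|block I (J :\ c) S c set0| * N ^ #|I|.-1 <= #|I|`! * #|B|.
  have : #|block I (J :\ c) S c set0| <=
         \sum_(rho in I) #|block I (S :\ x) (J :\ c) x (I :\ rho)|.
    rewrite -(card_in_imset (f := conjugate)); last first.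
      by move=> L L' /blockP[Ll _ _ _] /blockP[L'l _ _ _]; apply: conjugate_inj.
    rewrite (leq_trans _ (card_bigcup_leq _ _ _)) //.
    apply/subset_leq_card/subsetP => _ /imsetP[L LB ->].
    have [rho rhoI LB'] := block_conjugate cardJ1 cardS xS LB.
    by apply/bigcupP; exists rho.
  move=> le; rewrite (leq_trans (leq_mul le (leqnn _))) // big_distrl /=.
  have step rho : rho \in I ->
      #|block I (S :\ x) (J :\ c) x (I :\ rho)| * N ^ #|I|.-1 <= #|I|.-1`! * #|B|.
    move=> rhoI; have -> : #|I|.-1 = #|I :\ rho| by rewrite (cardsD1 rho I) rhoI.
    exact: block_card cardS1 (negbT (setD11 x S)) (subD1set I rho).
  rewrite (leq_trans (leq_sum _ step)) // sum_nat_const mulnA.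
  by rewrite -cardJ1 factS.
have -> : (2 * #|I|).-1 = #|I| + #|I|.-1 by rewrite -cardJ1; lia.
rewrite expnD mulnA (leq_trans (leq_mul first (leqnn _))) //.
by rewrite -mulnA -mulnn -[X in _ <= X]mulnA leq_mul2l second orbT.
Qed.

(** * Recovering the location and counting all subsquares of one order *)

(** Some row of [I] shows all of [S] in [J]. Each row of [I] misses at most one of the two or more
    symbols, and rows outside [I] show none, as the columns of [J] spend [S] inside [I]. *)
Lemma block_determined I J S c L :
    #|J|.+1 = #|I| -> #|S| = #|J| -> 1 < #|J| -> L \in block I J S c set0 ->
  exists2 rho, S = [set L rho d | d in J] &
    I = [set i | [exists d in J, L i d \in S]].
Proof.
move=> cardJ cardS J_gt1 LB; have [Ll cov mis _] := blockP _ _ _ _ _ _ LB.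
have [rho rhoI full] : exists2 rho, rho \in I & missing L J S rho = set0.
  (* Otherwise [#|J| * #|S|] entries would fit into [#|I| * (#|J| - 1)] places. *)
  pose occ i y := [exists d in J, L i d == y].
  have count : #|J| * #|J| <= \sum_(i in I) #|[set y in S | occ i y]|.
    have -> : \sum_(i in I) #|[set y in S | occ i y]| =
              \sum_(y in S) #|[set i in I | occ i y]|.
      under eq_bigr do rewrite -sum1dep_card.
      under [RHS]eq_bigr do rewrite -sum1dep_card.
      rewrite (exchange_big_dep (mem S)) /=; last by move=> i y _ /andP[].
      by apply: eq_bigr => y yS; apply: eq_bigl => i; rewrite yS.
    rewrite -{1}cardS -sum_nat_const; apply: leq_sum => y yS.
    exact: block_rows LB yS.
  apply/'exists_in_eqP; apply: contraTT count => /exists_inPn nofull.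
  rewrite -ltnNge (@leq_ltn_trans (\sum_(i in I) #|J|.-1)) //; last first.
    by rewrite sum_nat_const -cardJ; nia.
  apply: leq_sum => i iI; have := nofull i iI; case/set0Pn => y.
  rewrite inE => /andP[yS /forall_inP yJ].
  have := cardsD1 y S; rewrite yS cardS add1n => ->.
  apply/subset_leq_card/subsetP => z; rewrite !inE => /andP[-> /exists_inP[d dJ /eqP<-]].
  by rewrite yJ.
exists rho.
  apply/eqP; rewrite eqEcard cardS leq_imset_card andbT.
  apply/subsetP => y yS; have := in_set0 y; rewrite -full inE yS /=.
  move/negbT; rewrite negb_forall_in => /exists_inP[d dJ].
  by rewrite negbK => /eqP<-; apply: imset_f.
apply/setP => i; rewrite inE; apply/idP/exists_inP => [iI|[d dJ iS]]; last first.
  by have [r rI /(latin_col Ll)<-] := cov d _ dJ iS.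
have : ~~ (S \subset missing L J S i).
  apply: contraTN J_gt1 => /subset_leq_card; rewrite cardS => le.
  by rewrite -leqNgt (leq_trans le) ?mis.
case/subsetPn => y yS; rewrite inE yS negb_forall_in => /exists_inP[d dJ].
by rewrite negbK => /eqP e; exists d; rewrite ?e.
Qed.

Definition locations (s : nat) :=
  [set p : {set 'I_k} * {set 'I_n} * {set 'I_n} |
    [&& #|p.1.1| == s, #|p.1.2| == s & #|p.2| == s]].

Lemma with_subsquare_total s : 2 < s ->
  (\sum_(p in locations s) #|with_subsquare p.1.1 p.1.2 p.2|) * (n - s) ^ (2 * s).-1
    <= s`! ^ 2 * (n * n * k * 'C(n, s.-1) * #|[set L | latin L]|).
Proof.
(* A location yields the default value that [el] needs; without locations the sum is empty. *)
move=> s_gt2; have [p0 p0s|none] := pickP (mem (locations s)); last first.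
  by rewrite big_pred0.
have [x0 _] : exists x0, x0 \in p0.2.
  by apply/card_gt0P; move: p0s; rewrite !inE => /and3P[_ _ /eqP->]; lia.
pose el (A : {set 'I_n}) := odflt x0 [pick x in A].
have elP (A : {set 'I_n}) : 0 < #|A| -> el A \in A.
  by move/card_gt0P => [a aA]; rewrite /el; case: pickP => // /(_ a); rewrite aA.
pose B (p : {set 'I_k} * {set 'I_n} * {set 'I_n}) :=
  block p.1.1 (p.2 :\ el p.2) (p.1.2 :\ el p.1.2) (el p.2) set0.
have le1 : (\sum_(p in locations s) #|with_subsquare p.1.1 p.1.2 p.2|) * (n - s) ^ (2 * s).-1
    <= s`! ^ 2 * \sum_(p in locations s) #|B p|.
  rewrite big_distrl big_distrr /=; apply: leq_sum => -[[I J] S].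
  rewrite inE /= => /and3P[/eqP cI /eqP cJ /eqP cS]; rewrite -cI.
  by apply: with_subsquare_card; rewrite ?cI ?cJ ?cS ?elP ?cJ ?cS //; lia.
rewrite (leq_trans le1) // leq_mul2l; apply/orP; right.
have -> : \sum_(p in locations s) #|B p| =
          \sum_(L | latin L) #|[set p in locations s | L \in B p]|.
  under eq_bigr do rewrite -sum1_card.
  under [RHS]eq_bigr do rewrite -sum1dep_card.
  rewrite (exchange_big_dep (fun L => latin L)) /=; last by move=> p L _ /blockP[].
  by [].
rewrite cardsE mulnC -sum_nat_const leq_sum // => L Ll.
(* Conjugate roles: [q.2] is a symbol set without the point [q.1.1.2], and the local [S] is a column
   set without the point [q.1.1.1]. *)
pose decode (q : 'I_n * 'I_n * 'I_k * {set 'I_n}) :=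
  let S := [set L q.1.2 d | d in q.2] in
  ([set i | [exists d in q.2, L i d \in S]], q.1.1.1 |: S, q.1.1.2 |: q.2).
have -> : n * n * k * 'C(n, s.-1) =
    #|setX (setX (setX [set: 'I_n] [set: 'I_n]) [set: 'I_k])
        [set A : {set 'I_n} | #|A| == s.-1]|.
  by rewrite !cardsX card_draws !cardsT !card_ord.
rewrite (leq_trans _ (leq_imset_card decode _)) //.
apply/subset_leq_card/subsetP => -[[I J] S] /setIdP[].
rewrite inE /= => /and3P[/eqP cI /eqP cJ /eqP cS]; rewrite /B /= => LB.
have cJ1 : #|J :\ el J|.+1 = s by rewrite -cJ (cardsD1 (el J) J) elP // cJ; lia.
have cS1 : #|S :\ el S|.+1 = s by rewrite -cS (cardsD1 (el S) S) elP // cS; lia.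
have [|||rho rhoE IE] := block_determined _ _ _ LB; [by rewrite cS1|lia|lia|].
apply/imsetP; exists (el J, el S, rho, S :\ el S).
  by rewrite !inE -cS1 /=.
by rewrite /decode /= -rhoE -IE !setD1K ?elP ?cJ ?cS //; lia.
Qed.

(** * Link to the original definitions and the union bound *)

Lemma latin_rectangleE : 0 < k <= n -> latin_rectangles k n = [set L | latin L].
Proof.
move=> kn; apply/setP => L; rewrite !inE /latin_rectangle kn cardsT card_ord eqxx /=.
apply/and3P/latinP => [[_ /forallP row /forallP col]|[row col]].
  split=> [i c d e|d i r /= e].
    by have /forall_inP/(_ (L i d) (in_setT _))/card_le1_eqP := row i; apply; rewrite inE ?e.
  by have /forall_inP/(_ (L r d) (in_setT _))/card_le1_eqP := col d; apply; rewrite inE ?e.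
split.
- by apply/forallP => i; apply/forallP => d; rewrite inE.
- apply/forallP => i; apply/forall_inP => x _; apply/card_le1_eqP => c d.
  by rewrite !inE => /eqP e /eqP e'; apply: (row i); rewrite e e'.
- apply/forallP => d; apply/forall_inP => x _; apply/card_le1_eqP => i r.
  by rewrite !inE => /eqP e /eqP e'; apply: (col d); rewrite /= e e'.
Qed.

(** A column outside [J] meets the rows of [I] in [#|I|] symbols outside [S], since those rows use
    up [S] within [J]. *)
Lemma subsquare_order L I J S : latin L -> #|J| = #|I| -> #|S| = #|I| ->
  #|I| < n -> L \in with_subsquare I J S -> 2 * #|I| <= n.
Proof.
move=> Ll cJ cS In; rewrite inE Ll /= => /forall_inP LS.
have [c cJ'] : exists c, c \notin J.
  have : ~~ ([set: 'I_n] \subset J).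
    by apply: contraTN In => /subset_leq_card; rewrite cardsT card_ord cJ leqNgt.
  by case/subsetPn => c _; exists c.
pose T := [set L i c | i in I].
have cT : #|T| = #|I| by rewrite card_imset // => i r; apply: latin_col.
have disj : [disjoint S & T].
  rewrite disjoint_sym disjoint_subset; apply/subsetP => _ /imsetP[i iI ->]; rewrite inE.
  have /eqP <- : [set L i d | d in J] == S.
    rewrite eqEcard cS card_imset ?cJ ?leqnn ?andbT; last by move=> d d'; apply: latin_row.
    by apply/subsetP => _ /imsetP[d dJ ->]; move/forall_inP: (LS i iI); apply.
  by apply: contra cJ' => /imsetP[d dJ /(latin_row Ll)->].
have := subset_leq_card (subsetT (S :|: T)).
by rewrite cardsT card_ord cardsU disjoint_setI0 // cards0 subn0 cS cT mul2n addnn.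
Qed.

(** A union bound over orders and locations, cut off at [n./2] by [subsquare_order]. *)
Lemma card_has_proper_subsquare : 0 < k <= n ->
  #|[set L in latin_rectangles k n | has_proper_subsquare_ge 4 L]|
    <= \sum_(4 <= s < n./2.+1) \sum_(p in locations s) #|with_subsquare p.1.1 p.1.2 p.2|.
Proof.
move=> kn; rewrite latin_rectangleE //.
pose U s : {set 'M['I_n]_(k, n)} := \bigcup_(p in locations s) with_subsquare p.1.1 p.1.2 p.2.
apply: (@leq_trans (\sum_(4 <= s < n./2.+1) #|U s|)); last first.
  by apply: leq_sum => s _; apply: card_bigcup_leq.
rewrite (leq_trans _ (card_bigcup_leq _ _ _)) //.
apply/subset_leq_card/subsetP => L; rewrite !inE => /andP[Ll].
case/existsP => I /existsP[J /andP[/andP[/existsP[S]]]].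
case/and3P => /eqP cIJ _ /and4P[/eqP cSJ /forallP LS _ _] /andP[_ In] I4.
have LU : L \in with_subsquare I J S.
  rewrite inE Ll; apply/forall_inP => i iI; apply/forall_inP => d dJ.
  have /forallP/(_ (enum_rank_in dJ d)) := LS (enum_rank_in iI i).
  by rewrite mxE !enum_rankK_in.
have In' : #|I| < n by lia.
have := subsquare_order Ll (esym cIJ) (etrans cSJ (esym cIJ)) In' LU => I2.
rewrite (big_rem #|I|) /=; last by rewrite mem_index_iota I4 ltnS geq_half_double -mul2n.
rewrite in_setU; apply/orP; left; apply/bigcupP; exists (I, J, S) => //.
by rewrite inE /= cSJ -cIJ !eqxx.
Qed.

(** The cyclic rectangle [i + d] modulo [n] is a witness; probabilities thus have a nonzero
    denominator. *)
Lemma card_latin_gt0 : k <= n -> 0 < #|[set L | latin L]|.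
Proof.
move=> kn; apply/card_gt0P.
pose f (i : 'I_k) (d : 'I_n) : 'I_n :=
  Ordinal (ltn_pmod (i + d) (leq_ltn_trans (leq0n d) (ltn_ord d))).
exists (\matrix_(i, d) f i d)%R; rewrite inE; apply/latinP; split.
  move=> i c d; rewrite !mxE => /(congr1 val)/eqP /=.
  by rewrite eqn_modDl !modn_small // => /eqP/val_inj.
move=> d i r /=; rewrite !mxE => /(congr1 val)/eqP /=.
rewrite eqn_modDr !modn_small ?(leq_trans (ltn_ord _)) // => /eqP; exact: val_inj.
Qed.
End Rectangles.

(** * Numerical estimates *)

(** AM-GM for the product of [m + 1] to [m + s], whose mean is [(2 * m + s.+1) / 2]. The induction
    keeps two terms of the binomial expansion of [a.+1 ^ s.+1]. *)
Lemma ffact_AGM m s : 2 ^ s * (m + s) ^_ s <= (2 * m + s.+1) ^ s.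
Proof.
elim: s => [|s IH]; first by rewrite addn0 ffactn0.
rewrite addnS ffactSS expnS mulnACA (leq_trans (leq_mul (leqnn _) IH)) //.
set a := 2 * m + s.+1; have -> : 2 * m + s.+2 = a.+1 by rewrite addnS.
have -> : 2 * (m + s).+1 = a + s.+1 by rewrite /a; lia.
rewrite mulnDl -expnS -(addn1 a) expnDn big_ord_recl /= big_ord_recl /=.
by rewrite subn0 bin0 !exp1n !muln1 !mul1n bin1 subn1 /= addnA leq_addr.
Qed.

Lemma order_total_le n k s A M : k <= n -> 0 < s -> 2 * s <= n ->
  A * (n - s) ^ (2 * s).-1 <= s`! ^ 2 * (n * n * k * 'C(n, s.-1) * M) ->
  A * (4 * (n - s) ^ 2) ^ s <= n ^ 3 * s * (s.+1 * (2 * n - s + 1)) ^ s * M.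
Proof.
case: s => // s kn _ sn le.
set N := n - s.+1 in le *.
(* From here [s] is the order minus one. The factor [n - s] completes the binomial coefficient to a
   falling factorial; [NleS] trades one factor [N] for it. *)
have E : s.+1`! ^ 2 * 'C(n, s) * (n - s) = s.+1 * (s.+1`! * n ^_ s.+1).
  by rewrite ffactnSr -bin_ffact factS; ring.
have AGMn : 2 ^ s.+1 * n ^_ s.+1 <= (2 * n - s.+1 + 1) ^ s.+1.
  have e1 : N + s.+1 = n by rewrite /N; lia.
  have e2 : 2 * N + s.+2 = 2 * n - s.+1 + 1 by rewrite /N; lia.
  by have := ffact_AGM N s.+1; rewrite e1 e2.
have AGMs : 2 ^ s.+1 * s.+1`! <= s.+2 ^ s.+1.
  by have := ffact_AGM 0 s.+1; rewrite muln0 !add0n ffactnn.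
have -> : (4 * N ^ 2) ^ s.+1 = N ^ (2 * s.+1).-1 * N * 4 ^ s.+1.
  by rewrite -expnSr prednK ?muln_gt0 // expnMn -expnM mulnC.
have NleS : N <= n - s by rewrite /N; lia.
rewrite 2!mulnA (leq_trans (leq_mul (leq_mul le NleS) (leqnn _))) //.
have -> : s.+1`! ^ 2 * (n * n * k * 'C(n, s.+1.-1) * M) * (n - s) * 4 ^ s.+1 =
   n * n * k * s.+1 * ((2 ^ s.+1 * s.+1`!) * (2 ^ s.+1 * n ^_ s.+1)) * M.
  have -> : 4 ^ s.+1 = 2 ^ s.+1 * 2 ^ s.+1 by rewrite -expnMn.
  transitivity ((s.+1`! ^ 2 * 'C(n, s) * (n - s)) * (n * n * k * M * (2 ^ s.+1 * 2 ^ s.+1))).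
    by rewrite /=; ring.
  by rewrite E; ring.
rewrite leq_mul2r; apply/orP; right; rewrite expnMn; apply: leq_mul (leq_mul AGMs AGMn).
by rewrite leq_mul2r; apply/orP; right; rewrite !expnS expn0 muln1 mulnA leq_mul2l kn orbT.
Qed.

Local Open Scope ring_scope.

(* Chosen so that (51/50)^5 * 7/8 <= 97/100. *)
Lemma nat_le_expn (R : realFieldType) (s : nat) : s%:R <= 50 * (51 / 50) ^+ s :> R.
Proof.
suff : 1 + s%:R / 50 <= (51 / 50) ^+ s :> R by lra.
elim: s => [|s IH]; first by rewrite expr0 mul0r addr0.
have s0 : 0 <= s%:R :> R := ler0n _ _.
rewrite exprS -natr1; nra.
Qed.

(** Four of the [s] factors [rho] use [4 * s / n], beating the cube of [n] by one power; the others
    use [7 / 8], whose decay absorbs the fifth power of [s]. *)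
Lemma order_bound (R : realFieldType) : exists2 K : R, 0 <= K &
  forall n k s A M : nat, (100 <= n)%N -> (k <= n)%N -> (4 <= s)%N -> (2 * s <= n)%N ->
  (A * (n - s) ^ (2 * s).-1 <= s`! ^ 2 * (n * n * k * 'C(n, s.-1) * M))%N ->
  A%:R <= K / n%:R * (97 / 100) ^+ s * M%:R.
Proof.
(* 256 is the fourth power of the 4 in [rho2], the power of 50 comes from [nat_le_expn], and [8 / 7]
   makes up for the exponent [s - 4]. *)
exists (256 * 50 ^+ 5 * (8 / 7) ^+ 4).
  by rewrite !mulr_ge0 ?exprn_ge0 //; lra.
move=> n k s A M n100 kn s4 sn /(order_total_le kn (ltnW (ltnW (ltnW s4))) sn) le.
have n0 : 0 < n%:R :> R by rewrite ltr0n; lia.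
pose N : R := (n - s)%:R.
have N0 : 0 < N by rewrite ltr0n; lia.
pose rho : R := (s.+1 * (2 * n - s + 1))%:R / (4 * N ^+ 2).
have rho_ge0 : 0 <= rho by rewrite divr_ge0 // mulr_ge0 // sqr_ge0.
have N2 : 0 < 4 * N ^+ 2 by rewrite mulr_gt0 // exprn_gt0.
have {le} A_le : A%:R <= n%:R ^+ 3 * s%:R * rho ^+ s * M%:R :> R.
  rewrite expr_div_n -(ler_pM2r (exprn_gt0 s N2)).
  have -> : n%:R ^+ 3 * s%:R *
      ((s.+1 * (2 * n - s + 1))%:R ^+ s / (4 * N ^+ 2) ^+ s) * M%:R * (4 * N ^+ 2) ^+ s =
    n%:R ^+ 3 * s%:R * (s.+1 * (2 * n - s + 1))%:R ^+ s * M%:R :> R.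
    by field; rewrite expf_neq0 // lt0r_neq0.
  by move: le; rewrite -(ler_nat R) !(natrM, natrX).
(* The worst case [n = 2 * s] gives nearly [3 / 4]; for [n] at least 100 the lower-order terms fit
   into the gap. *)
have rho1 : rho <= 7 / 8.
  rewrite ler_pdivrMr // /N -natrX.
  have : (8 * (s.+1 * (2 * n - s + 1)) <= 7 * (4 * (n - s) ^ 2))%N.
    have -> : (2 * n - s + 1 = 3 * s + 2 * (n - 2 * s) + 1)%N by lia.
    have -> : (n - s = s + (n - 2 * s))%N by lia.
    have : (100 <= 2 * s + (n - 2 * s))%N by lia.
    by move: (n - 2 * s)%N => d; case: (ltnP s 10) => s10; nia.
  by rewrite -(ler_nat R) !natrM; lra.
have rho2 : rho <= 4 * s%:R / n%:R.
  rewrite ler_pdivrMr // mulrAC ler_pdivlMr // /N -natrX.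
  have : (s.+1 * (2 * n - s + 1) * n <= 4 * s * (4 * (n - s) ^ 2))%N.
    have le1 : (s.+1 * (2 * n - s + 1) <= 4 * s * n)%N by nia.
    have le2 : (n * n <= 4 * (n - s) ^ 2)%N by nia.
    by rewrite (leq_trans (leq_mul le1 (leqnn n))) // -mulnA leq_mul2l le2 orbT.
  by rewrite -(ler_nat R) !natrM.
have rhos : rho ^+ s <= (4 * s%:R / n%:R) ^+ 4 * (7 / 8) ^+ (s - 4).
  rewrite -[in X in X <= _](subnKC s4) exprD.
  by apply: ler_pM; rewrite ?exprn_ge0 ?lerXn2r ?nnegrE //; lra.
have pow : (7 / 8) ^+ (s - 4) = (7 / 8) ^+ s * (8 / 7) ^+ 4 :> R.
  rewrite -[in X in _ = X * _](subnK s4) exprD -mulrA -exprMn.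
  by rewrite (_ : 7 / 8 * (8 / 7) = 1) ?expr1n ?mulr1 //; lra.
have s5 : s%:R ^+ 5 * (7 / 8) ^+ s <= 50 ^+ 5 * (97 / 100) ^+ s :> R.
  have le1 : s%:R ^+ 5 <= (50 * (51 / 50) ^+ s) ^+ 5 :> R.
    by rewrite lerXn2r ?nnegrE ?nat_le_expn // mulr_ge0 // exprn_ge0 //; lra.
  rewrite (le_trans (ler_wpM2r _ le1)) ?exprn_ge0 //; first by lra.
  rewrite exprMn -mulrA ler_wpM2l ?exprn_ge0 // exprAC -exprMn lerXn2r ?nnegrE //; lra.
rewrite (le_trans A_le) // ler_wpM2r //.
have ns : 0 <= n%:R ^+ 3 * s%:R :> R by rewrite mulr_ge0 ?exprn_ge0.
rewrite (le_trans (ler_wpM2l ns rhos)) // pow.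
have -> : n%:R ^+ 3 * s%:R * ((4 * s%:R / n%:R) ^+ 4 * ((7 / 8) ^+ s * (8 / 7) ^+ 4)) =
  256 * (8 / 7) ^+ 4 / n%:R * (s%:R ^+ 5 * (7 / 8) ^+ s) :> R.
  by field; rewrite lt0r_neq0.
have -> : 256 * 50 ^+ 5 * (8 / 7) ^+ 4 / n%:R * (97 / 100) ^+ s =
  256 * (8 / 7) ^+ 4 / n%:R * (50 ^+ 5 * (97 / 100) ^+ s) :> R by ring.
by rewrite ler_wpM2l // divr_ge0 ?mulr_ge0 ?exprn_ge0 //; lra.
Qed.

Lemma geometric_sum_le (R : realFieldType) (z : R) (m p : nat) : 0 <= z < 1 ->
  \sum_(m <= i < p) z ^+ i <= (1 - z)^-1.
Proof.
move=> /andP[z0 z1].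
have z_le1 i : z ^+ i <= 1 by rewrite exprn_ile1 // ltW.
rewrite -[leRHS]mul1r ler_pdivlMr ?subr_gt0 //.
have E d : (\sum_(m <= i < m + d) z ^+ i) * (1 - z) = z ^+ m - z ^+ (m + d).
  elim: d => [|d IH]; first by rewrite addn0 big_geq // mul0r subrr.
  by rewrite addnS big_nat_recr ?leq_addr //= mulrDl IH exprS; ring.
have [pm|/ltnW/subnKC pE] := leqP p m; first by rewrite big_geq // mul0r.
by rewrite -pE E lerBlDr (le_trans (z_le1 m)) // lerDl exprn_ge0.
Qed.

(** * The probability bound and its asymptotic form *)

Lemma no_proper_subsquare_prob (R : realFieldType) : exists2 K : R, 0 <= K &
  forall k n : nat, (100 <= n)%N -> (0 < k <= n)%N ->
  `|finite_uniform_prob R (latin_rectangles k n)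
      (fun L => ~~ has_proper_subsquare_ge 4 L) - 1|
    <= K / n%:R.
Proof.
have [K K0 KP] := order_bound R.
(* The geometric series of ratio [97 / 100] contributes [100 / 3], rounded up generously. *)
exists (K * 100).
  by rewrite mulr_ge0.
move=> k n n100 /[dup] kn0 /andP[k0 kn].
rewrite /finite_uniform_prob.
set A := latin_rectangles k n.
set good := #|[set _ in A | _]|.
pose bad := #|[set L in A | has_proper_subsquare_ge 4 L]|.
have A0 : 0 < #|A|%:R :> R.
  by rewrite ltr0n /A latin_rectangleE // card_latin_gt0.
have gb : (good + bad)%N = #|A|.
  rewrite addnC -[RHS](cardsID [set L | has_proper_subsquare_ge 4 L] A).
  by congr (_ + _)%N; apply: eq_card => L; rewrite !inE // andbC.
have -> : good%:R / #|A|%:R - 1 = - (bad%:R / #|A|%:R) :> R.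
  by rewrite -gb natrD in A0 *; field; exact: lt0r_neq0.
rewrite normrN ger0_norm ?divr_ge0 // ler_pdivrMr //.
have bad_le : bad%:R <= \sum_(4 <= s < n./2.+1)
    (\sum_(p in locations k n s) #|with_subsquare p.1.1 p.1.2 p.2|)%:R :> R.
  by rewrite -natr_sum ler_nat; apply: card_has_proper_subsquare.
rewrite (le_trans bad_le) //.
have order_le s : (4 <= s < n./2.+1)%N ->
    (\sum_(p in locations k n s) #|with_subsquare p.1.1 p.1.2 p.2|)%:R <=
      K / n%:R * #|A|%:R * (97 / 100) ^+ s.
  move=> /andP[s4 sn]; rewrite mulrAC; apply: (KP _ _ _ _ _ n100 kn s4).
    by rewrite mul2n -geq_half_double -ltnS.
  rewrite /A latin_rectangleE //; exact/with_subsquare_total/ltnW.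
rewrite (le_trans (ler_sum_nat order_le)) // -mulr_sumr.
have KA : 0 <= K / n%:R * #|A|%:R by rewrite mulr_ge0 // divr_ge0.
rewrite (le_trans (ler_wpM2l KA (geometric_sum_le _ _ _))) //; first by lra.
rewrite (_ : (1 - 97 / 100)^-1 = 100 / 3); last by field.
by move: KA; lra.
Qed.

From mathcomp Require Import all_classical all_reals all_analysis.
Import numFieldNormedType.Exports.
Local Open Scope classical_set_scope.
Local Open Scope ring_scope.

Theorem corollary1p2 (R : realType) (k : nat -> nat)
    (hk : forall n : nat, (0 < n)%N -> (0 < k n <= n)%N) :
  (fun n : nat =>
     finite_uniform_prob R (latin_rectangles (k n) n)
       (fun L => ~~ has_proper_subsquare_ge 4 L))
  = (fun=> 1) +O_\oo (fun n : nat => n%:R^-1 : R).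
Proof.
have [K K0 KP] := no_proper_subsquare_prob R.
(* Any constant [M] at least [K] works from [n = 100] on. *)
apply/eqaddOP; near=> M; near=> n.
have n100 : (100 <= n)%N by near: n; exact: nbhs_infty_ge.
rewrite (le_trans (KP _ _ n100 (hk n (leq_trans _ n100)))) //.
rewrite ger0_norm ?invr_ge0 // ler_wpM2r ?invr_ge0 //.
Unshelve. all: by end_near. Qed.
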